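(* There exist universal constants $\epsilon>0$ and $C>0$ such that the following holds. Let $A$ be a finite nonempty subset of an abelian group $\mathcal{Z}$ and let $K$ be defined by $|A-A| = K|A|$. Then there exists a set $A'\subset A-A$ satisfying $$|A'| \geq K^{-C}|A|$$ and $$E(A') \gtrapprox \frac{1}{K^{1-\epsilon}}.$$ Furthermore, one can take $\epsilon = \frac{1}{37}$.
   Context: For a finite nonempty set $B$ in an abelian group $\mathcal{Z}$, the (normalized) additive energy is $E(B) = |B|^{-3}\sum_{z\in\mathcal{Z}}|(z+B)\cap B|^2 = |B|^{-3}|\{(b_1,b_2,b_3,b_4)\in B^4: b_1-b_2=b_3-b_4\}|$. $A-A=\{a-a': a,a'\in A\}$. The notation $X\gtrapprox Y$ means: for every $\delta>0$ there is a constant $C_\delta>0$, independent of $K$ and of $A$, $\mathcal{Z}$, such that $Y\le C_\delta K^{\delta} X$. *)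

(* Defs.v *)
From HB Require Import structures.
From mathcomp Require Import all_boot all_order all_algebra finmap.
From mathcomp Require Import reals exp.
Set Implicit Arguments.
Unset Strict Implicit.
Unset Printing Implicit Defensive.
Import Order.TTheory GRing.Theory Num.Theory.
Local Open Scope fset_scope.
Local Open Scope ring_scope.

Definition diffset (Z : zmodType) (A : {fset Z}) : {fset Z} :=
  [fset a - a' | a in A, a' in A].

Definition energy_quadruples (Z : zmodType) (B : {fset Z}) :
    {fset (Z * Z) * (Z * Z)} :=
  [fset q in (B `*` B) `*` (B `*` B) | q.1.1 - q.1.2 == q.2.1 - q.2.2].

(* Since 0 / 0 = 0, the empty set gets energy 0. *)
Definition energy (R : realType) (Z : zmodType) (B : {fset Z}) : R :=
  #|` energy_quadruples B|%:R / #|` B|%:R ^+ 3.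

(* X \gtrapprox Y, with the family of constants c delta = C_delta made explicit
   so that its independence of K, A and Z can be expressed by quantifier order. *)
Definition gtrapprox (R : realType) (c : R -> R) (K X Y : R) : Prop :=
  forall delta : R, 0 < delta -> Y <= c delta * K `^ delta * X.

Definition large_energetic_subset (R : realType) (eps C : R) : Prop :=
  exists2 c : R -> R, (forall delta, 0 < delta -> 0 < c delta) &
  forall (Z : zmodType) (A : {fset Z}) (K : R),
    A != fset0 ->
    #|` diffset A|%:R = K * #|` A|%:R ->
    exists A' : {fset Z},
      [/\ A' `<=` diffset A,
          K `^ (- C) * #|` A|%:R <= #|` A'|%:R
        & gtrapprox c K (energy R A') (1 / K `^ (1 - eps))].

(* Main.v *)
(** Write [B_y] for [B] intersected with [B + y], and suppose that every large
    subset [X] of [A - A] has energy at most [kappa = K^-(36/37)]. Since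
    [A - B_y] is contained in [D] and in [D - y] for [D = A - B], Cauchy-Schwarz
    bounds the energies of [D] and of any set [Y] of differences of [B] from
    below, whence [|Y| * min_y |A - B_y|^4 <= kappa^2 * |D|^5]. This is used on
    three nested levels. With [B = A] it yields [x] such that [|A - A_x|] is
    about [K^(1/2) |A|] at most; with [B = A_x] it bounds [|A - B_y|] above in
    terms of the number of [y] having a given multiplicity [|B_y|]; and with
    [B_y] in place of [B], the trivial bound [|A - C| >= |A|] for nonempty [C]
    bounds [|A - B_y|] below. Up to constants the three estimates give
    [1 <= kappa^167 * K^161], which is absurd for large [K] because
    [167 * 36 / 37 > 162]. For bounded [K] a translate of [A] works, its energy
    being at least [1 / K]. *)

Require Import Defs.
From mathcomp Require Import all_boot all_order all_algebra finmap.
From mathcomp Require Import zify ring lra.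
From mathcomp Require Import boolp reals exp.
Set Implicit Arguments.
Unset Strict Implicit.
Unset Printing Implicit Defensive.
Import Order.TTheory GRing.Theory Num.Theory.
Local Open Scope fset_scope.
Local Open Scope ring_scope.

(** * Cauchy-Schwarz and sums over finite sets *)

Lemma CauchySchwarz_sum (R : realFieldType) (I : Type) (s : seq I)
    (f g : I -> R) :
  (\sum_(i <- s) f i * g i) ^+ 2
    <= (\sum_(i <- s) f i ^+ 2) * (\sum_(i <- s) g i ^+ 2).
Proof.
elim: s => [|i s IH]; first by rewrite !big_nil; lra.
rewrite !big_cons; move: IH.
have : 0 <= \sum_(j <- s) f j ^+ 2 by apply: sumr_ge0 => j _; exact: sqr_ge0.
have : 0 <= \sum_(j <- s) g j ^+ 2 by apply: sumr_ge0 => j _; exact: sqr_ge0.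
set F := \sum_(_ <- _) f _ ^+ 2; set G := \sum_(_ <- _) g _ ^+ 2.
set S := \sum_(_ <- _) _; move: (f i) (g i) => a b G0 F0 SFG.
(* The cross term is handled by AM-GM on [F * b ^+ 2] and [G * a ^+ 2], squared so that the
   induction hypothesis [S ^+ 2 <= F * G] applies. *)
suff le2 : 2 * (S * (a * b)) <= F * b ^+ 2 + G * a ^+ 2.
  have -> : (a * b + S) ^+ 2 = (a * b) ^+ 2 + S ^+ 2 +
    2 * (S * (a * b)) by ring.
  have -> : (a ^+ 2 + F) * (b ^+ 2 + G) =
    (a * b) ^+ 2 + F * G + (F * b ^+ 2 + G * a ^+ 2) by ring.
  by rewrite lerD // lerD2l.
have rhs0 : 0 <= F * b ^+ 2 + G * a ^+ 2.
  by apply: addr_ge0; apply: mulr_ge0 => //; exact: sqr_ge0.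
have [le0|lt0] := lerP (2 * (S * (a * b))) 0; first exact: le_trans rhs0.
rewrite -ler_sqr ?nnegrE ?(ltW lt0) //.
apply: (@le_trans _ _ (4 * (F * G * (a * b) ^+ 2))).
  have -> : (2 * (S * (a * b))) ^+ 2 = 4 * (S ^+ 2 * (a * b) ^+ 2) by ring.
  by rewrite ler_pM2l ?ltr0n // ler_wpM2r // sqr_ge0.
rewrite -subr_ge0.
have -> : (F * b ^+ 2 + G * a ^+ 2) ^+ 2 - 4 * (F * G * (a * b) ^+ 2) =
  (F * b ^+ 2 - G * a ^+ 2) ^+ 2 by ring.
exact: sqr_ge0.
Qed.

Lemma big_fsetM (R : nmodType) (K K' : choiceType) (A : {fset K})
    (B : {fset K'}) (F : K * K' -> R) :
  \sum_(p <- A `*` B) F p = \sum_(a <- A) \sum_(b <- B) F (a, b).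
Proof.
rewrite -big_allpairs; apply: perm_big; apply: uniq_perm.
- exact: fset_uniq.
- by apply: allpairs_uniq; rewrite ?fset_uniq // => -[? ?] [? ?].
move=> [a b]; rewrite in_fsetM /=; apply/idP/allpairsP => [/andP[aA bB]|].
  by exists (a, b).
by case=> -[x y] [xA yB [-> ->]]; apply/andP.
Qed.

Lemma sum_eq_fset (R : pzSemiRingType) (K : choiceType) (A : {fset K}) u :
  \sum_(x <- A) (x == u)%:R = (u \in A)%:R :> R.
Proof.
have [uA|uA] := boolP (u \in A).
  rewrite (big_fsetD1 u) //= eqxx big_seq big1 ?addr0 // => x.
  by rewrite in_fsetD1 => /andP[/negPf->].
by rewrite big_seq big1 // => x xA; case: eqP => // xu; rewrite -xu xA in uA.
Qed.

Lemma card_fset_sumr (R : pzSemiRingType) (K : choiceType) (A : {fset K})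
    (P : pred K) :
  #|` [fset x in A | P x]|%:R = \sum_(x <- A) (P x)%:R :> R.
Proof.
rewrite card_fset_sum1 natr_sum -big_fset_condE big_mkcond /=.
by apply: eq_bigr => x _; case: (P x).
Qed.

Lemma card_fsetE (R : pzSemiRingType) (K : choiceType) (A : {fset K}) :
  #|` A|%:R = \sum_(x <- A) 1 :> R.
Proof. by rewrite card_fset_sum1 natr_sum. Qed.

Lemma subr_eqC (Z : zmodType) (u v w : Z) : (u - v == w) = (v == u - w).
Proof. by apply/eqP/eqP => [<-|->]; rewrite subKr. Qed.

(** * Difference sets, representation counts and cross energy *)

Definition diff_fset (Z : zmodType) (A B : {fset Z}) : {fset Z} :=
  [fset a - b | a in A, b in B].

(** This is [B_z]; its cardinality counts the representations of [z] as a difference of two elements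
    of [B]. *)
Definition self_meet (Z : zmodType) (B : {fset Z}) (z : Z) : {fset Z} :=
  [fset b in B | b - z \in B].

Definition cross_energy (R : pzSemiRingType) (Z : zmodType) (X Y : {fset Z})
    : R :=
  \sum_(p <- X `*` X) \sum_(q <- Y `*` Y) (p.1 - p.2 == q.1 - q.2)%:R.

Lemma mem_diff_fset (Z : zmodType) (A B : {fset Z}) a b :
  a \in A -> b \in B -> a - b \in diff_fset A B.
Proof. by move=> aA bB; apply/imfset2P; exists a => //; exists b. Qed.

Lemma card_self_meet (R : pzSemiRingType) (Z : zmodType) (X : {fset Z}) z :
  #|` self_meet X z|%:R = \sum_(p <- X `*` X) (p.1 - p.2 == z)%:R :> R.
Proof.
rewrite card_fset_sumr big_fsetM; apply: eq_bigr => x _.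
rewrite -sum_eq_fset; apply: eq_bigr => x' _ /=; congr (nat_of_bool _)%:R.
exact/esym/subr_eqC.
Qed.

(** Quadruples are grouped by their common difference [z]. A [z] outside [X - X] contributes
    nothing, so [S] may be any larger set, which lets several energies be expanded over the same
    one. *)
Lemma cross_energyE (R : comPzSemiRingType) (Z : zmodType) (X Y S : {fset Z}) :
  diff_fset X X `<=` S ->
  cross_energy R X Y =
    \sum_(z <- S) #|` self_meet X z|%:R * #|` self_meet Y z|%:R.
Proof.
move=> /fsubsetP XS.
under [RHS]eq_bigr do rewrite !card_self_meet big_distrlr /=.
rewrite exchange_big /cross_energy /= [LHS]big_seq [RHS]big_seq.
apply: eq_bigr => p; rewrite in_fsetM => /andP[p1 p2].
rewrite exchange_big /=; apply: eq_bigr => q _.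
have [pq|npq] := eqVneq (p.1 - p.2) (q.1 - q.2).
  transitivity (\sum_(z <- S) (z == p.1 - p.2)%:R : R).
    by rewrite sum_eq_fset XS // mem_diff_fset.
  apply: eq_bigr => z _; rewrite -pq eq_sym.
  by case: eqP; rewrite ?mulr1 ?mulr0.
rewrite big1 // => z _; case: eqP => [<-|]; last by rewrite mul0r.
by rewrite eq_sym (negPf npq) mulr0.
Qed.

Lemma card_energy_quadruples (R : pzSemiRingType) (Z : zmodType)
    (X : {fset Z}) :
  #|` energy_quadruples X|%:R = cross_energy R X X.
Proof. by rewrite card_fset_sumr big_fsetM. Qed.

Lemma cross_energy_ge0 (R : numDomainType) (Z : zmodType) (X Y : {fset Z}) :
  0 <= cross_energy R X Y.
Proof. by apply: sumr_ge0 => p _; apply: sumr_ge0 => q _; exact: ler0n. Qed.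

Lemma cross_energy_CauchySchwarz (R : realFieldType) (Z : zmodType)
    (X Y : {fset Z}) :
  cross_energy R X Y ^+ 2 <= cross_energy R X X * cross_energy R Y Y.
Proof.
pose S := diff_fset X X `|` diff_fset Y Y.
rewrite !(@cross_energyE _ _ _ _ S) ?fsubsetUl ?fsubsetUr //.
exact: CauchySchwarz_sum.
Qed.

Lemma sum_self_meet (R : comPzSemiRingType) (Z : zmodType) (X S : {fset Z}) :
  diff_fset X X `<=` S ->
  \sum_(z <- S) #|` self_meet X z|%:R = #|` X|%:R ^+ 2 :> R.
Proof.
move=> /fsubsetP XS; under eq_bigr do rewrite card_self_meet.
have -> : #|` X|%:R ^+ 2 = \sum_(p <- X `*` X) 1 :> R.
  rewrite big_fsetM expr2 !card_fsetE mulr_suml.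
  by apply: eq_bigr => x _; rewrite mul1r.
rewrite exchange_big /= [LHS]big_seq [RHS]big_seq; apply: eq_bigr => p.
rewrite in_fsetM => /andP[p1 p2].
under eq_bigr do rewrite eq_sym.
by rewrite sum_eq_fset XS // mem_diff_fset.
Qed.

Lemma cross_energy_shift (R : pzSemiRingType) (Z : zmodType) (X : {fset Z}) t :
  cross_energy R [fset x - t | x in X] [fset x - t | x in X] =
  cross_energy R X X.
Proof.
have inj : {in X &, injective (fun x => x - t)} by move=> x y _ _; exact: addIr.
have sub x y : x - t - (y - t) = x - y by rewrite opprB addrA subrK.
rewrite /cross_energy !big_fsetM big_imfset //=; apply: eq_bigr => x _.
rewrite big_imfset //=; apply: eq_bigr => x' _.
rewrite !big_fsetM big_imfset //=; apply: eq_bigr => y _.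
by rewrite big_imfset //=; apply: eq_bigr => y' _; rewrite !sub.
Qed.

(** * Energy bounds from shifts of a difference set *)

(** Let [N d] count the [y] in [Y] with [d + y] in [D]. Cauchy-Schwarz over [d] leaves the sum of
    [N d ^+ 2], which counts triples [(d, y, y')]; these inject into energy quadruples, since
    [d + y] and [d + y'] lie in [D] and differ by [y - y']. *)
Lemma shift_count_bound (R : realFieldType) (Z : zmodType) (D Y : {fset Z}) :
  (\sum_(y <- Y) #|` [fset d in D | d + y \in D]|%:R) ^+ 2
    <= #|` D|%:R * cross_energy R Y D.
Proof.
under eq_bigr do rewrite card_fset_sumr.
rewrite exchange_big /=; set N := fun d => \sum_(y <- Y) (d + y \in D)%:R : R.
rewrite (eq_bigr (fun d => 1 * N d)); last by move=> d _; rewrite mul1r.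
apply: (le_trans (CauchySchwarz_sum _ _ _)).
under eq_bigr do rewrite expr1n; rewrite -card_fsetE ler_wpM2l ?ler0n //.
under eq_bigr do rewrite expr2 big_distrlr
  -(big_fsetM Y Y (fun p => (_ + p.1 \in D)%:R * (_ + p.2 \in D)%:R)) /=.
rewrite exchange_big; apply: ler_sum => -[y y'] _ /=; rewrite big_fsetM.
(* Substitute [u = d + y], so that [d + y' = u - (y - y')]. *)
apply: (@le_trans _ _ (\sum_(u <- D) (u - (y - y') \in D)%:R)); last first.
  apply: ler_sum => u _; rewrite -sum_eq_fset; apply: ler_sum => v _ /=.
  by rewrite [y - y' == _]eq_sym subr_eqC.
under eq_bigr do rewrite -sum_eq_fset mulr_suml.
rewrite exchange_big /=; apply: ler_sum => u _.
apply: (@le_trans _ _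
  (\sum_(d <- D) (d == u - y)%:R * (u - (y - y') \in D)%:R)).
  apply: ler_sum => d _; case: eqP => [->|_]; last by rewrite mul0r mulr_ge0.
  by rewrite addrK eqxx opprB addrA addrAC addrK.
rewrite -mulr_suml sum_eq_fset -natrM ler_nat.
by case: (u - y \in D); rewrite ?mul1n ?mul0n.
Qed.

Lemma card_fset_shift (Z : zmodType) (A : {fset Z}) t :
  #|` [fset x - t | x in A]| = #|` A|.
Proof. by apply: card_imfset; exact: addIr. Qed.

Lemma card_diff_fset_ge (Z : zmodType) (A B : {fset Z}) :
  B != fset0 -> (#|` A| <= #|` diff_fset A B|)%N.
Proof.
case/fset0Pn => b bB; rewrite -(card_fset_shift A b).
apply/fsubset_leq_card/fsubsetP => _ /imfsetP[/= x xA ->].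
exact: mem_diff_fset.
Qed.

Lemma diff_fsetS (Z : zmodType) (A A' B B' : {fset Z}) :
  A `<=` A' -> B `<=` B' -> diff_fset A B `<=` diff_fset A' B'.
Proof.
move=> /fsubsetP sA /fsubsetP sB.
apply/fsubsetP => _ /imfset2P[/= a aA [b bB ->]].
by apply: mem_diff_fset; [apply: sA | apply: sB].
Qed.

Lemma self_meet_sub (Z : zmodType) (B : {fset Z}) y : self_meet B y `<=` B.
Proof. by apply/fsubsetP => x; rewrite !inE => /andP[]. Qed.

Lemma diff_self_meet_sub (Z : zmodType) (A B : {fset Z}) y :
  diff_fset A (self_meet B y) `<=`
    [fset d in diff_fset A B | d + y \in diff_fset A B].
Proof.
apply/fsubsetP => _ /imfset2P[/= a aA [b bBy ->]].
move: bBy; rewrite !inE /= => /andP[bB byB].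
have -> : a - b + y = a - (b - y) by rewrite addrAC opprB addrA.
by rewrite !mem_diff_fset.
Qed.

(** By [diff_self_meet_sub], [|Y| * mu] is at most the shift count of [D] over [Y]. Two uses of
    Cauchy-Schwarz give [(|Y| * mu)^4 <= |D|^2 * E(Y) * E(D)] for unnormalized energies [E]; the two
    energy hypotheses then let [|Y|^3] cancel. *)
Lemma energy_pair_bound (R : realFieldType) (Z : zmodType) (A B Y : {fset Z})
    (kappa mu : R) (D := diff_fset A B) :
  Y != fset0 -> 0 <= mu ->
  cross_energy R D D <= kappa * #|` D|%:R ^+ 3 ->
  cross_energy R Y Y <= kappa * #|` Y|%:R ^+ 3 ->
  (forall y, y \in Y -> mu <= #|` diff_fset A (self_meet B y)|%:R) ->
  #|` Y|%:R * mu ^+ 4 <= kappa ^+ 2 * #|` D|%:R ^+ 5.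
Proof.
move=> Y0 mu0 eD eY hmu.
have Ypos : 0 < #|` Y|%:R :> R by rewrite ltr0n cardfs_gt0.
have le_sum : #|` Y|%:R * mu <=
    \sum_(y <- Y) #|` [fset d in D | d + y \in D]|%:R.
  rewrite card_fsetE mulr_suml [leRHS]big_seq [leLHS]big_seq.
  apply: ler_sum => y yY; rewrite mul1r; apply: (le_trans (hmu _ yY)).
  by rewrite ler_nat; apply/fsubset_leq_card/diff_self_meet_sub.
have sq_le := shift_count_bound R D Y.
have cs := cross_energy_CauchySchwarz R Y D.
have eY0 := cross_energy_ge0 R Y Y; have eD0 := cross_energy_ge0 R D D.
have e0 := cross_energy_ge0 R Y D.
have D0 : 0 <= #|` D|%:R :> R by [].
move: le_sum sq_le cs eY0 eD0 e0 eD eY Ypos D0.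
set E := cross_energy R Y D; set y := #|` Y|%:R; set d := #|` D|%:R.
set S := \sum_(_ <- _) _; set eY := cross_energy R Y Y.
set eD := cross_energy R D D => h1 h2 h3 eY0 eD0 E0 h4 h5 y0 d0.
have h6 : E ^+ 2 <= kappa * y ^+ 3 * (kappa * d ^+ 3).
  by apply: (le_trans h3); rewrite ler_pM.
have h7 : (y * mu) ^+ 2 <= d * E.
  apply: le_trans h2; rewrite ler_sqr ?nnegrE ?mulr_ge0 ?(ltW y0) //.
  by apply: le_trans h1; rewrite mulr_ge0 ?(ltW y0).
have h8 : ((y * mu) ^+ 2) ^+ 2 <= (d * E) ^+ 2.
  by rewrite ler_sqr ?nnegrE ?mulr_ge0 ?sqr_ge0.
rewrite -(ler_pM2l (exprn_gt0 3 y0)).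
have -> : y ^+ 3 * (y * mu ^+ 4) = ((y * mu) ^+ 2) ^+ 2 by ring.
apply: (le_trans h8); rewrite exprMn.
apply: (le_trans (ler_wpM2l (sqr_ge0 d) h6)).
by rewrite le_eqVlt; apply/predU1P; left; ring.
Qed.

(** The element [y] minimizes [|A - B_y|] over [Y], and [mu] is taken to be this minimum. *)
Lemma energy_pair_choice (R : realFieldType) (Z : zmodType) (A B Y : {fset Z})
    (kappa : R) (D := diff_fset A B) :
  Y != fset0 ->
  cross_energy R D D <= kappa * #|` D|%:R ^+ 3 ->
  cross_energy R Y Y <= kappa * #|` Y|%:R ^+ 3 ->
  exists2 y, y \in Y &
    #|` Y|%:R * #|` diff_fset A (self_meet B y)|%:R ^+ 4
      <= kappa ^+ 2 * #|` D|%:R ^+ 5.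
Proof.
move=> Y0 eD eY; have /fset0Pn[y0 y0Y] := Y0.
pose f (y : Y) := #|` diff_fset A (self_meet B (fsval y))|.
case: (@arg_minnP _ [` y0Y] xpredT f isT) => y _ ymin.
exists (fsval y); first exact: fsvalP.
apply: energy_pair_bound => // z zY; rewrite ler_nat.
exact: (ymin [` zY]).
Qed.

(** * Popular differences *)

(** Unpopular differences carry at most half of the [|X|^2] representations. Cauchy-Schwarz on the
    popular half bounds [|X|^4 / 4] by the energy of [X] times [|Y|], so low energy forces many
    popular differences. *)
Lemma popular_differences (R : realFieldType) (Z : zmodType) (X S : {fset Z})
    (kappa : R)
    (Y := [fset z in S |
      #|` X|%:R ^+ 2 <= 2 * #|` S|%:R * #|` self_meet X z|%:R :> R]) :
  X != fset0 -> diff_fset X X `<=` S ->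
  cross_energy R X X <= kappa * #|` X|%:R ^+ 3 ->
  #|` X|%:R <= 4 * kappa * #|` Y|%:R.
Proof.
move=> X0 XS eX.
have Xpos : 0 < #|` X|%:R :> R by rewrite ltr0n cardfs_gt0.
have Spos : 0 < #|` S|%:R :> R.
  rewrite ltr0n (leq_trans _ (fsubset_leq_card XS)) //.
  by rewrite (leq_trans _ (card_diff_fset_ge X X0)) ?cardfs_gt0.
pose r z : R := #|` self_meet X z|%:R.
pose i z : R := (#|` X|%:R ^+ 2 <= 2 * #|` S|%:R * r z :> R)%:R.
have cs := CauchySchwarz_sum S r i.
have iE : \sum_(z <- S) i z ^+ 2 = #|` Y|%:R.
  rewrite /Y card_fset_sumr; apply: eq_bigr => z _; rewrite /i.
  by case: (_ <= _); rewrite ?expr1n ?expr0n.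
have rE : \sum_(z <- S) r z ^+ 2 = cross_energy R X X.
  by rewrite (cross_energyE _ _ XS); apply: eq_bigr => z _; rewrite expr2.
have half : #|` X|%:R ^+ 2 <= \sum_(z <- S) r z * i z + #|` X|%:R ^+ 2 / 2.
  have -> : #|` X|%:R ^+ 2 / 2 =
      \sum_(z <- S) #|` X|%:R ^+ 2 / (2 * #|` S|%:R) :> R.
    under eq_bigr do rewrite -[_ / _]mul1r.
    rewrite -mulr_suml -card_fsetE; field.
    by rewrite gt_eqF.
  rewrite -{1}(sum_self_meet R XS) -big_split /=; apply: ler_sum => z _.
  rewrite /i; have [_|lt] := leP (#|` X|%:R ^+ 2) (2 * #|` S|%:R * r z).
    by rewrite mulr1 lerDl divr_ge0 ?sqr_ge0 ?mulr_ge0.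
  by rewrite mulr0 add0r ler_pdivlMr ?mulr_gt0 // mulrC ltW.
move: cs half; rewrite rE iE; move: eX Xpos.
set x := #|` X|%:R; set w := \sum_(_ <- _) _ * _; set y := #|` Y|%:R.
move=> eX x0 cs half.
have y0 : 0 <= y by [].
have hw : x ^+ 2 / 2 <= w by lra.
have hw2 : (x ^+ 2 / 2) ^+ 2 <= kappa * x ^+ 3 * y.
  apply: (@le_trans _ _ (w ^+ 2)).
    rewrite ler_sqr ?nnegrE ?divr_ge0 ?sqr_ge0 //.
    by rewrite (le_trans _ hw) ?divr_ge0 ?sqr_ge0.
  by apply: (le_trans cs); rewrite ler_wpM2r.
rewrite -(ler_pM2l (exprn_gt0 3 x0)).
have -> : x ^+ 3 * x = 4 * (x ^+ 2 / 2) ^+ 2 by field.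
have -> : x ^+ 3 * (4 * kappa * y) = 4 * (kappa * x ^+ 3 * y) by ring.
by rewrite ler_pM2l.
Qed.

(** * Consequences of low energy in all large subsets *)

(** The assumption to be refuted, eventually with [theta = K^-4 * |A|] and [kappa = K^-(36/37)]. *)
Definition low_energy_subsets (R : realFieldType) (Z : zmodType) (D : {fset Z})
    (theta kappa : R) : Prop :=
  forall X : {fset Z}, X `<=` D -> theta <= #|` X|%:R ->
    cross_energy R X X <= kappa * #|` X|%:R ^+ 3.

(** [B] itself need not lie in [A - A], but its translate by an element of [B] does, and energy is
    translation invariant. *)
Lemma low_energy_summand (R : realFieldType) (Z : zmodType) (A B : {fset Z})
    (theta kappa : R) :
  low_energy_subsets (diff_fset A A) theta kappa -> B `<=` A ->
  theta <= #|` B|%:R -> cross_energy R B B <= kappa * #|` B|%:R ^+ 3.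
Proof.
move=> low sBA thB; have [->|/fset0Pn[b bB]] := eqVneq B fset0.
  by rewrite /cross_energy big_fsetM big_seq_fset0 cardfs0 expr0n mulr0.
rewrite -(cross_energy_shift _ _ b) -(card_fset_shift B b).
apply: low; last by rewrite card_fset_shift.
apply/fsubsetP => _ /imfsetP[/= x xB ->].
by apply: mem_diff_fset; exact: (fsubsetP sBA).
Qed.

(** Innermost level: for a popular difference [y] of [B] the set [B_y] is nonempty, so [mu = |A|] is
    admissible in [energy_pair_bound], and [|Y|] is at least [|B| / (4 * kappa)]. As [kappa <= 1],
    the factor 4 before [theta] makes [Y] large enough. *)
Lemma summand_le_diff (R : realFieldType) (Z : zmodType) (A B : {fset Z})
    (theta kappa : R) :
  0 < kappa -> kappa <= 1 -> low_energy_subsets (diff_fset A A) theta kappa ->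
  B `<=` A -> B != fset0 -> 4 * theta <= #|` B|%:R ->
  #|` B|%:R * #|` A|%:R ^+ 4 <= 4 * kappa ^+ 3 * #|` diff_fset A B|%:R ^+ 5.
Proof.
move=> k0 k1 low sBA B0 thB; pose D := diff_fset A A.
have Bpos : 0 < #|` B|%:R :> R by rewrite ltr0n cardfs_gt0.
have thB' : theta <= #|` B|%:R by lra.
have eB := low_energy_summand low sBA thB'.
have := popular_differences B0 (diff_fsetS sBA sBA) eB.
set Y := [fset z in _ | _] => BY.
have Ypos : 0 < #|` Y|%:R :> R.
  rewrite lt_neqAle ler0n andbT eq_sym; apply/eqP => Y0.
  by move: BY; rewrite Y0 mulr0 leNgt Bpos.
have Y0 : Y != fset0 by rewrite -cardfs_gt0 -(ltr0n R).
have thY : theta <= #|` Y|%:R.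
  have : kappa * #|` Y|%:R <= #|` Y|%:R by rewrite ler_piMl // ltW.
  by lra.
have eY : cross_energy R Y Y <= kappa * #|` Y|%:R ^+ 3.
  by apply: low => //; apply/fsubsetP => z; rewrite !inE => /andP[].
have leAB : #|` A|%:R <= #|` diff_fset A B|%:R :> R.
  by rewrite ler_nat card_diff_fset_ge.
have leBA : #|` B|%:R <= #|` A|%:R :> R by rewrite ler_nat fsubset_leq_card.
have eD : cross_energy R (diff_fset A B) (diff_fset A B)
    <= kappa * #|` diff_fset A B|%:R ^+ 3.
  by apply: low; [exact: diff_fsetS | lra].
have hY : #|` Y|%:R * #|` A|%:R ^+ 4 <= kappa ^+ 2 * #|` diff_fset A B|%:R ^+ 5.
  apply: energy_pair_bound => // y; rewrite !inE => /andP[_ ypop].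
  rewrite ler_nat card_diff_fset_ge // -cardfs_gt0 lt0n; apply/eqP => r0.
  by move: ypop; rewrite r0 mulr0 leNgt exprn_gt0.
apply: (@le_trans _ _ (4 * kappa * (#|` Y|%:R * #|` A|%:R ^+ 4))).
  by rewrite mulrA ler_wpM2r ?exprn_ge0.
have -> : 4 * kappa ^+ 3 * #|` diff_fset A B|%:R ^+ 5 =
  4 * kappa * (kappa ^+ 2 * #|` diff_fset A B|%:R ^+ 5) by ring.
by rewrite ler_pM2l // mulr_gt0.
Qed.

(** For the [y] minimizing [M = |A - B_y|], [energy_pair_choice] bounds [M^4] above and
    [summand_le_diff] for [B_y] bounds [M^5] below. Their fifth and fourth powers share [M^20],
    which is eliminated. *)
Lemma self_meet_level_bound (R : realFieldType) (Z : zmodType)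
    (A B Y : {fset Z}) (theta kappa t : R) :
  0 < theta -> 0 < kappa -> kappa <= 1 ->
  low_energy_subsets (diff_fset A A) theta kappa ->
  B `<=` A -> B != fset0 -> theta <= #|` B|%:R ->
  Y `<=` diff_fset A A -> theta <= #|` Y|%:R -> 0 <= t ->
  (forall y, y \in Y ->
     t <= #|` self_meet B y|%:R /\ 4 * theta <= #|` self_meet B y|%:R) ->
  #|` Y|%:R ^+ 5 * t ^+ 4 * #|` A|%:R ^+ 16
    <= 256 * kappa ^+ 22 * #|` diff_fset A B|%:R ^+ 25.
Proof.
move=> th0 k0 k1 low sBA B0 thB sYD thY t0 Yt.
have Y0 : Y != fset0 by rewrite -cardfs_gt0 -(ltr0n R) (lt_le_trans th0).
have leAB : #|` A|%:R <= #|` diff_fset A B|%:R :> R.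
  by rewrite ler_nat card_diff_fset_ge.
have leBA : #|` B|%:R <= #|` A|%:R :> R by rewrite ler_nat fsubset_leq_card.
have eD : cross_energy R (diff_fset A B) (diff_fset A B)
    <= kappa * #|` diff_fset A B|%:R ^+ 3.
  by apply: low; [exact: diff_fsetS | lra].
have [y yY ley] := energy_pair_choice Y0 eD (low _ sYD thY).
have [tr thr] := Yt _ yY.
have r0 : self_meet B y != fset0.
  by rewrite -cardfs_gt0 -(ltr0n R) (lt_le_trans _ thr) // mulr_gt0.
have sByA := fsubset_trans (self_meet_sub B y) sBA.
have := summand_le_diff k0 k1 low sByA r0 thr.
move: ley tr; set M := #|` diff_fset A (self_meet B y)|%:R.
set D := #|` diff_fset A B|%:R; set r := #|` self_meet B y|%:R.
set Y' := #|` Y|%:R; set a := #|` A|%:R => h1 h2 h3.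
have [a0 M0 D0 Y'0] : [/\ 0 <= a, 0 <= M, 0 <= D & 0 <= Y'] by [].
have h4 : (Y' * M ^+ 4) ^+ 5 <= (kappa ^+ 2 * D ^+ 5) ^+ 5.
  by apply: lerXn2r; rewrite ?nnegrE ?mulr_ge0 ?exprn_ge0 ?(ltW k0).
have h5 : (t * a ^+ 4) ^+ 4 <= (4 * kappa ^+ 3 * M ^+ 5) ^+ 4.
  apply: lerXn2r; rewrite ?nnegrE ?mulr_ge0 ?exprn_ge0 ?(ltW k0) //.
  by apply: le_trans h3; rewrite ler_wpM2r ?exprn_ge0.
have -> : Y' ^+ 5 * t ^+ 4 * a ^+ 16 = Y' ^+ 5 * (t * a ^+ 4) ^+ 4 by ring.
apply: (le_trans (ler_wpM2l (exprn_ge0 5 Y'0) h5)).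
have -> : Y' ^+ 5 * (4 * kappa ^+ 3 * M ^+ 5) ^+ 4 =
  256 * kappa ^+ 12 * (Y' * M ^+ 4) ^+ 5 by ring.
have -> : 256 * kappa ^+ 22 * D ^+ 25 =
  256 * kappa ^+ 12 * (kappa ^+ 2 * D ^+ 5) ^+ 5 by ring.
by rewrite ler_wpM2l // mulr_ge0 ?exprn_ge0 ?(ltW k0).
Qed.

(** * Summation over level sets *)

Lemma sum_ltn_minn (R : pzSemiRingType) m n :
  \sum_(t < m) (t < n)%N%:R = (minn m n)%:R :> R.
Proof.
elim: m => [|m IH]; first by rewrite big_ord0 min0n.
rewrite big_ord_recr /= IH -natrD; congr _%:R.
by case: (ltnP m n) => /=; lia.
Qed.

Lemma powR_invn5 (R : realType) (x : R) : 0 <= x -> (x `^ 5^-1) ^+ 5 = x.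
Proof.
move=> x0; rewrite -powR_mulrn ?powR_ge0 // -powRrM mulVf ?powRr1 //.
by rewrite pnatr_eq0.
Qed.

(* Convexity: [5 u ^ 4 (u - v) - (u ^ 5 - v ^ 5)] is [(u - v) ^ 2] times a
   polynomial with nonnegative coefficients. *)
Lemma fifth_root_step (R : realFieldType) (f h u v : R) :
  0 <= f -> 0 <= h -> 0 <= u -> 0 <= v -> u ^+ 5 = v ^+ 5 + 1 ->
  f ^+ 5 * (u ^+ 5) ^+ 4 <= h ^+ 5 -> f <= 5 * h * (u - v).
Proof.
move=> f0 h0 u0 v0 uv fuh.
have vu : v <= u.
  rewrite leNgt; apply/negP => lt; have : u ^+ 5 < v ^+ 5 by rewrite ltrXn2r.
  by rewrite uv; lra.
have fu : f * u ^+ 4 <= h.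
  rewrite leNgt; apply/negP => lt.
  have : h ^+ 5 < (f * u ^+ 4) ^+ 5 by rewrite ltrXn2r // mulr_ge0 ?exprn_ge0.
  have -> : (f * u ^+ 4) ^+ 5 = f ^+ 5 * (u ^+ 5) ^+ 4 by ring.
  by rewrite ltNge fuh.
have step : 1 <= 5 * u ^+ 4 * (u - v).
  have -> : 5 * u ^+ 4 * (u - v) = u ^+ 5 - v ^+ 5 +
      (u - v) ^+ 2 * (4 * u ^+ 3 + 3 * u ^+ 2 * v + 2 * u * v ^+ 2 + v ^+ 3).
    by ring.
  have -> : u ^+ 5 - v ^+ 5 = 1 by rewrite uv; ring.
  by rewrite lerDl mulr_ge0 ?sqr_ge0 // !addr_ge0 ?mulr_ge0 ?exprn_ge0.
apply: (@le_trans _ _ (f * (5 * u ^+ 4 * (u - v)))).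
  by rewrite -{1}[f]mulr1 ler_wpM2l.
have -> : f * (5 * u ^+ 4 * (u - v)) = 5 * (f * u ^+ 4) * (u - v) by ring.
by rewrite ler_wpM2r ?subr_ge0 // ler_wpM2l.
Qed.

(* [t ^ (- 4 / 5)] is summable near 0, so a weak-type bound on the level sets
   controls the sum without a logarithmic loss. *)
Lemma weak_type_sum (R : realType) (I : Type) (s : seq I) (r : I -> nat)
    (m : nat) (s0 H theta : R) :
  0 <= H -> 0 <= theta ->
  (forall t : nat,
     let f := \sum_(z <- s) ((t < r z)%N && (s0 <= (r z)%:R))%:R in
     theta < f -> f ^+ 5 * t.+1%:R ^+ 4 <= H) ->
  exists2 g, 0 <= g /\ g ^+ 5 <= 5 ^+ 5 * H * m%:R &
    \sum_(z <- s) ((s0 <= (r z)%:R) && (r z <= m)%N)%:R * (r z)%:R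
      <= g + m%:R * theta.
Proof.
move=> H0 th0 hf; pose u (t : nat) : R := t%:R `^ 5^-1; pose h := H `^ 5^-1.
have u5 t : u t ^+ 5 = t%:R by rewrite powR_invn5.
have h5 : h ^+ 5 = H by rewrite powR_invn5.
have h0 : 0 <= h by exact: powR_ge0.
have u0 t : 0 <= u t by exact: powR_ge0.
exists (5 * h * u m); first by rewrite !mulr_ge0 // !exprMn h5 u5.
pose f t : R := \sum_(z <- s) ((t < r z)%N && (s0 <= (r z)%:R))%:R.
have f0 t : 0 <= f t by apply: sumr_ge0 => z _; exact: ler0n.
(* Level sets of size at most [theta] escape the hypothesis and cost [theta] each; the others are
   bounded by increments of the fifth root, which telescope. *)
have ft t : f t <= 5 * h * (u t.+1 - u t) + theta.
  have [lef|gtf] := leP (f t) theta.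
    apply: (le_trans lef); rewrite lerDr !mulr_ge0 // subr_ge0.
    by rewrite ge0_ler_powR ?nnegrE ?invr_ge0 ?ler_nat.
  have := hf t gtf; rewrite -/(f t) => hft.
  apply: ler_wpDr => //; apply: fifth_root_step => //.
    by rewrite !u5 -natr1.
  by rewrite u5 h5.
have -> : 5 * h * u m + m%:R * theta =
    \sum_(t < m) (5 * h * (u t.+1 - u t) + theta).
  rewrite big_split /= sumr_const card_ord [m%:R * _]mulr_natl -mulr_sumr.
  rewrite -(big_mkord xpredT (fun t => u t.+1 - u t)) telescope_sumr //.
  have -> : u 0%N = 0 by rewrite /u powR0 // invr_eq0 pnatr_eq0.
  by rewrite subr0.
apply: (@le_trans _ _ (\sum_(t < m) f t)); last by apply: ler_sum => t _.
(* Layer-cake: when [r z <= m], exactly [r z] of the indices [t < m] satisfy [t < r z]. *)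
rewrite exchange_big /=; apply: ler_sum => z _.
have [s0r|_] := leP s0 (r z)%:R; last by rewrite mul0r sumr_ge0.
under eq_bigr do rewrite andbT; rewrite sum_ltn_minn.
case: (leqP (r z) m) => rm; last by rewrite mul0r.
by rewrite mul1r.
Qed.

(** * Combining the nested levels *)

(** For [a = |A|], [b = |A_x|], [d = |A - A_x|]. The three bounds, raised to the powers 36, 25 and
    4, share [b^36] and [d^100]; cancelling [a^100] leaves [K] to the power [36 + 125] and [kappa]
    to the power [92 + 75]. *)
Lemma doubling_exponents (R : realFieldType) (a b d K kappa p q c : R) :
  0 < a -> 0 <= b -> 0 <= d -> 0 <= K -> 0 <= kappa -> 0 <= p -> 0 <= q ->
  0 <= c ->
  a <= p * K * b -> d ^+ 4 <= q * kappa ^+ 3 * K ^+ 5 * a ^+ 4 ->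
  b ^+ 9 * a ^+ 16 <= c * kappa ^+ 23 * d ^+ 25 ->
  1 <= p ^+ 36 * c ^+ 4 * q ^+ 25 * kappa ^+ 167 * K ^+ 161.
Proof.
move=> a0 b0 d0 K0 k0 p0 q0 c0 ab da bd; have a0' := ltW a0.
have h1 : a ^+ 36 <= (p * K * b) ^+ 36.
  by apply: lerXn2r; rewrite ?nnegrE ?mulr_ge0.
have h2 : (d ^+ 4) ^+ 25 <= (q * kappa ^+ 3 * K ^+ 5 * a ^+ 4) ^+ 25.
  by apply: lerXn2r; rewrite ?nnegrE ?mulr_ge0 ?exprn_ge0.
have h3 : (b ^+ 9 * a ^+ 16) ^+ 4 <= (c * kappa ^+ 23 * d ^+ 25) ^+ 4.
  by apply: lerXn2r; rewrite ?nnegrE ?mulr_ge0 ?exprn_ge0.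
rewrite -(ler_pM2l (exprn_gt0 100 a0)) mulr1.
have -> : a ^+ 100 = a ^+ 36 * a ^+ 64 by rewrite -exprD.
apply: (le_trans (ler_wpM2r (exprn_ge0 64 a0') h1)).
have -> : (p * K * b) ^+ 36 * a ^+ 64 =
    p ^+ 36 * K ^+ 36 * (b ^+ 9 * a ^+ 16) ^+ 4.
  by ring.
have pK : 0 <= p ^+ 36 * K ^+ 36 by rewrite mulr_ge0 ?exprn_ge0.
apply: (le_trans (ler_wpM2l pK h3)).
have -> : p ^+ 36 * K ^+ 36 * (c * kappa ^+ 23 * d ^+ 25) ^+ 4 =
    p ^+ 36 * K ^+ 36 * c ^+ 4 * kappa ^+ 92 * (d ^+ 4) ^+ 25.
  by ring.
have pK' : 0 <= p ^+ 36 * K ^+ 36 * c ^+ 4 * kappa ^+ 92.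
  by rewrite !mulr_ge0 ?exprn_ge0.
apply: (le_trans (ler_wpM2l pK' h2)).
by rewrite le_eqVlt; apply/predU1P; left; ring.
Qed.

(** Outermost level: [x] is chosen among the popular differences of [A]. Popularity gives the first
    bound, and [|A| <= 4 * kappa * |Y|] turns [energy_pair_choice] into the second. *)
Lemma self_meet_choice (R : realFieldType) (Z : zmodType) (A : {fset Z})
    (theta kappa K : R) (D := diff_fset A A) :
  A != fset0 -> #|` D|%:R = K * #|` A|%:R -> 0 < kappa -> kappa <= 1 ->
  4 * theta <= #|` A|%:R -> low_energy_subsets D theta kappa ->
  exists x, #|` A|%:R <= 2 * K * #|` self_meet A x|%:R /\
    #|` diff_fset A (self_meet A x)|%:R ^+ 4
      <= 4 * kappa ^+ 3 * K ^+ 5 * #|` A|%:R ^+ 4.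
Proof.
move=> A0 DK k0 k1 thA low.
have a0 : 0 < #|` A|%:R :> R by rewrite ltr0n cardfs_gt0.
have thA' : theta <= #|` A|%:R by lra.
have eA := low_energy_summand low (fsubset_refl A) thA'.
have := popular_differences A0 (fsubset_refl D) eA.
set Y := [fset z in _ | _] => AY.
have Ypos : 0 < #|` Y|%:R :> R.
  rewrite lt_neqAle ler0n andbT eq_sym; apply/eqP => Y0.
  by move: AY; rewrite Y0 mulr0 leNgt a0.
have Y0 : Y != fset0 by rewrite -cardfs_gt0 -(ltr0n R).
have thY : theta <= #|` Y|%:R.
  have : kappa * #|` Y|%:R <= #|` Y|%:R by rewrite ler_piMl // ltW.
  by lra.
have sYD : Y `<=` D by apply/fsubsetP => z; rewrite !inE => /andP[].
have thD : theta <= #|` D|%:R.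
  by apply: (le_trans thA'); rewrite ler_nat card_diff_fset_ge.
have [x] := energy_pair_choice Y0 (low _ (fsubset_refl D) thD) (low _ sYD thY).
rewrite !inE -/D DK => /andP[_ popx] lex; exists x; split.
  rewrite -(ler_pM2l a0); apply: le_trans popx _.
  by rewrite le_eqVlt; apply/predU1P; left; ring.
move: lex; set M := #|` diff_fset _ _|%:R => lex.
rewrite -(ler_pM2l a0).
apply: (@le_trans _ _ (4 * kappa * (#|` Y|%:R * M ^+ 4))).
  by rewrite [leRHS]mulrA ler_wpM2r ?exprn_ge0.
apply: (@le_trans _ _ (4 * kappa * (kappa ^+ 2 * (K * #|` A|%:R) ^+ 5))).
  by rewrite ler_pM2l // mulr_gt0.
by rewrite le_eqVlt; apply/predU1P; left; ring.
Qed.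

(** Middle level: the [|B|^2] representations are split by multiplicity. Very small and very large
    multiplicities account for at most a quarter each, and [self_meet_level_bound] controls the rest
    through [weak_type_sum]. *)
Lemma summand_energy_bound (R : realType) (Z : zmodType) (A B : {fset Z})
    (theta kappa : R) (D := diff_fset A A) :
  B `<=` A -> B != fset0 -> 0 < theta -> 0 < kappa -> kappa <= 1 ->
  16 * theta <= #|` B|%:R -> 16 * #|` D|%:R * theta <= #|` B|%:R ^+ 2 ->
  low_energy_subsets D theta kappa ->
  #|` B|%:R ^+ 9 * #|` A|%:R ^+ 16
    <= 20 ^+ 5 * 1024 * kappa ^+ 23 * #|` diff_fset A B|%:R ^+ 25.
Proof.
move=> sBA B0 th0 k0 k1 thB thD low; set a := #|` A|%:R.
set b := #|` B|%:R in thB thD *; set d := #|` diff_fset A B|%:R.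
have thB' : theta <= #|` B|%:R by lra.
have b0 : 0 < b by rewrite ltr0n cardfs_gt0.
have a0 : 0 < a.
  by apply: (lt_le_trans b0); rewrite ler_nat fsubset_leq_card.
have eB := low_energy_summand low sBA thB'.
have sBD : diff_fset B B `<=` D by exact: diff_fsetS.
pose r z := #|` self_meet B z|.
(* Multiplicities above [T] contribute at most the energy divided by [T], that is
   [kappa * b^3 / T = b^2 / 4]. *)
pose T := 4 * kappa * b; have T0 : 0 < T by rewrite !mulr_gt0.
pose m := Num.trunc T; have /andP[mT Tm] := truncn_itv (ltW T0).
pose H := 256 * kappa ^+ 22 * d ^+ 25 / a ^+ 16.
have H0 : 0 <= H by rewrite !(mulr_ge0, invr_ge0, exprn_ge0) // ltW.
have [t|g [g0 g5] Wle] :=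
  @weak_type_sum R Z D r m (4 * theta) H theta H0 (ltW th0).
  rewrite -card_fset_sumr => f thf; rewrite ler_pdivlMr ?exprn_gt0 //.
  apply: (self_meet_level_bound th0 k0 k1 low) => //.
  - by apply/fsubsetP => z; rewrite !inE => /andP[].
  - exact: ltW.
  - by move=> y; rewrite !inE => /andP[_ /andP[tr thr]]; rewrite ler_nat.
have split_r z : (r z)%:R <= 4 * theta + (r z)%:R ^+ 2 / T +
    ((4 * theta <= (r z)%:R) && (r z <= m)%N)%:R * (r z)%:R.
  have r0 : 0 <= (r z)%:R :> R by [].
  have rT : 0 <= (r z)%:R ^+ 2 / T by rewrite divr_ge0 ?sqr_ge0 ?(ltW T0).
  have [le1|lt1] := leP (4 * theta) (r z)%:R; last by rewrite mul0r; lra.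
  case: (leqP (r z) m) => [le2|lt2]; first by rewrite mul1r; lra.
  suff : (r z)%:R <= (r z)%:R ^+ 2 / T by rewrite mul0r; lra.
  (* Since [m] is the integer part of [T], [m < r z] means [m.+1 <= r z], hence [T < r z]. *)
  rewrite ler_pdivlMr // expr2 ler_wpM2l // ltW // (lt_le_trans Tm) //.
  by rewrite ler_nat.
have eT : \sum_(z <- D) (r z)%:R ^+ 2 / T <= b ^+ 2 / 4.
  rewrite -mulr_suml ler_pdivrMr //.
  have -> : b ^+ 2 / 4 * T = kappa * b ^+ 3 by rewrite /T; field.
  apply: le_trans eB; rewrite (cross_energyE _ _ sBD).
  by apply: ler_sum => z _; rewrite expr2.
have b2 : b ^+ 2 <= #|` D|%:R * (4 * theta) + b ^+ 2 / 4 + (g + m%:R * theta).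
  rewrite -{1}(sum_self_meet R sBD).
  apply: (le_trans (ler_sum _ (fun z _ => split_r z))).
  rewrite !big_split /=; apply: lerD Wle; apply: lerD eT.
  rewrite card_fsetE mulr_suml; apply: ler_sum => z _.
  by rewrite mul1r.
(* The error term of [weak_type_sum] is the third quarter, so [g] must carry the last one. *)
have mth : m%:R * theta <= b ^+ 2 / 4.
  have h1 : m%:R * theta <= 4 * kappa * b * theta.
    by rewrite ler_wpM2r ?(ltW th0).
  have h2 : kappa * (b * theta) <= b * theta.
    by rewrite ler_piMl // mulr_ge0 ?ltW.
  have h3 : b * (16 * theta) <= b * b by rewrite ler_wpM2l ?(ltW b0).
  rewrite expr2; lra.
have bg : b ^+ 2 / 4 <= g by lra.
have bg5 : (b ^+ 2 / 4) ^+ 5 <= g ^+ 5.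
  by apply: lerXn2r; rewrite ?nnegrE ?divr_ge0 ?sqr_ge0.
have gT : g ^+ 5 <= 5 ^+ 5 * H * T.
  by apply: (le_trans g5); rewrite ler_wpM2l // mulr_ge0 ?exprn_ge0.
have a16 := exprn_gt0 16 a0.
rewrite -(ler_pM2l b0).
have -> : b * (b ^+ 9 * a ^+ 16) =
    4 ^+ 5 * (a ^+ 16 * (b ^+ 2 / 4) ^+ 5).
  by field.
have -> : b * (20 ^+ 5 * 1024 * kappa ^+ 23 * d ^+ 25) =
    4 ^+ 5 * (a ^+ 16 * (5 ^+ 5 * H * T)).
  by rewrite /H /T; field; rewrite gt_eqF.
by rewrite !ler_pM2l ?exprn_gt0 // (le_trans bg5).
Qed.

Lemma low_energy_doubling (R : realType) (Z : zmodType) (A : {fset Z})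
    (theta kappa K : R) (D := diff_fset A A) :
  A != fset0 -> #|` D|%:R = K * #|` A|%:R -> 1 <= K ->
  0 < theta -> 64 * K ^+ 3 * theta <= #|` A|%:R ->
  0 < kappa -> kappa <= 1 -> low_energy_subsets D theta kappa ->
  1 <= 2 ^+ 36 * (20 ^+ 5 * 1024) ^+ 4 * 4 ^+ 25 * kappa ^+ 167 * K ^+ 161.
Proof.
move=> A0 DK K1 th0 thA k0 k1 low; have K0 : 0 < K by exact: lt_le_trans K1.
have a0 : 0 < #|` A|%:R :> R by rewrite ltr0n cardfs_gt0.
have thK : theta <= K * theta by rewrite ler_peMl // ltW.
have thK2 : K * theta <= K ^+ 2 * theta.
  have -> : K ^+ 2 * theta = K * (K * theta) by ring.
  by rewrite ler_peMl // mulr_ge0 // ltW.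
have thK3 : K ^+ 2 * theta <= K ^+ 3 * theta.
  have -> : K ^+ 3 * theta = K * (K ^+ 2 * theta) by ring.
  by rewrite ler_peMl // mulr_ge0 ?exprn_ge0 // ltW.
have [|x [ab da]] := self_meet_choice A0 DK k0 k1 _ low; first by lra.
set b := #|` self_meet A x|%:R in ab.
(* As [b >= |A| / (2 * K)], this follows from the bound with [64 * K^3]. It implies both size
   conditions of [summand_energy_bound], the second because [|D| = K * |A| <= 2 * K^2 * b]. *)
have thb : 32 * K ^+ 2 * theta <= b.
  rewrite -(ler_pM2l K0); have -> : K * (32 * K ^+ 2 * theta) =
    64 * K ^+ 3 * theta / 2 by field.
  lra.
have B0 : self_meet A x != fset0.
  by rewrite -cardfs_gt0 -(ltr0n R) (lt_le_trans _ thb) // !mulr_gt0 ?exprn_gt0.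
apply: (doubling_exponents a0 _ _ (ltW K0) (ltW k0) _ _ _ ab da) => //.
  by rewrite mulr_ge0 ?exprn_ge0.
apply: (summand_energy_bound _ _ th0 k0 k1 _ _ low) => //.
  exact: self_meet_sub.
  by rewrite -/b; lra.
rewrite -/D DK -/b expr2.
apply: (@le_trans _ _ (16 * (K * (2 * K * b)) * theta)).
  by rewrite ler_wpM2r ?(ltW th0) // ler_pM2l // ler_wpM2l // ltW.
have -> : 16 * (K * (2 * K * b)) * theta = b * (32 * K ^+ 2 * theta) by ring.
by rewrite ler_wpM2l.
Qed.

(** * The energetic subset for bounded and for large [K] *)

Lemma card_le_diff_energy (R : realFieldType) (Z : zmodType) (X : {fset Z}) :
  #|` X|%:R ^+ 4 <= #|` diff_fset X X|%:R * cross_energy R X X.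
Proof.
have -> : #|` X|%:R ^+ 4 = (#|` X|%:R ^+ 2) ^+ 2 :> R by rewrite -exprM.
rewrite -(sum_self_meet R (fsubset_refl _)).
under eq_bigr do rewrite -[_%:R]mul1r.
apply: (le_trans (CauchySchwarz_sum _ _ _)).
under eq_bigr do rewrite expr1n; rewrite -card_fsetE ler_wpM2l //.
rewrite (cross_energyE _ _ (fsubset_refl _)).
by apply: ler_sum => z _; rewrite expr2.
Qed.

Lemma large_energetic_subset_37 (R : realType) :
  large_energetic_subset (1 / 37%:R : R) 4.
Proof.
pose N : R := 2 ^+ 36 * (20 ^+ 5 * 1024) ^+ 4 * 4 ^+ 25.
have N0 : 0 <= N by rewrite !(mulr_ge0, exprn_ge0).
(* For [K >= K0], the 64 gives [64 * K^3 * theta <= |A|] and the [N] gives [N / K < 1]. For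
   [K < K0], the constant itself absorbs [K]. *)
pose K0 : R := 64 + N.
exists (fun=> K0); first by move=> _ _; rewrite /K0; lra.
move=> Z A K A0; rewrite -[diffset A]/(diff_fset A A); set D := diff_fset A A.
move=> DK; have a0 : 0 < #|` A|%:R :> R by rewrite ltr0n cardfs_gt0.
have K1 : 1 <= K.
  by rewrite -(ler_pM2r a0) mul1r -DK ler_nat card_diff_fset_ge.
have Kpos : 0 < K by exact: lt_le_trans K1.
have K_delta delta : 0 < delta -> 1 <= K `^ delta.
  by move=> d0; rewrite -[leLHS](powRr0 K) ler_powR // ltW.
pose kappa := 1 / K `^ (1 - 1 / 37%:R).
have kappaE : kappa = K `^ (- (36 / 37)).
  by rewrite /kappa div1r -powRN; congr (_ `^ _); field.
have k0 : 0 < kappa by rewrite kappaE powR_gt0.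
have k1 : kappa <= 1 by rewrite kappaE -[leRHS](powRr0 K) ler_powR //; lra.
have powK4 : K `^ (- 4) = K ^- 4 by rewrite powRN powR_mulrn // ltW.
rewrite /gtrapprox -/kappa.
have [ltK|geK] := ltP K K0.
  have /fset0Pn[t tA] := A0; exists [fset x - t | x in A]; split.
  - by apply/fsubsetP => _ /imfsetP[/= x xA ->]; exact: mem_diff_fset.
  - rewrite card_fset_shift powK4 ler_piMl ?(ltW a0) //.
    by rewrite invf_le1 ?exprn_gt0 // exprn_ege1.
  move=> delta /K_delta Kd; apply: (le_trans k1).
  rewrite /energy card_energy_quadruples cross_energy_shift card_fset_shift.
  have := card_le_diff_energy R A; rewrite -/D DK.
  set e := cross_energy R A A => ae.
  have KE : 1 <= K * (e / #|` A|%:R ^+ 3).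
    rewrite mulrA ler_pdivlMr ?exprn_gt0 // mul1r -(ler_pM2l a0).
    by apply: le_trans (le_trans ae _);
      rewrite le_eqVlt; apply/predU1P; left; ring.
  have E0 : 0 <= e / #|` A|%:R ^+ 3.
    by rewrite divr_ge0 ?cross_energy_ge0 ?exprn_ge0.
  apply: (le_trans KE); rewrite ler_wpM2r // (le_trans (ltW ltK)) //.
  by rewrite ler_peMr // /K0; lra.
apply: contrapT => nex.
pose theta := K ^- 4 * #|` A|%:R.
have th0 : 0 < theta by rewrite mulr_gt0 ?invr_gt0 ?exprn_gt0.
(* A large [X] with energy above [kappa] would serve as [A'] for every [delta] at once, because [K0]
   and [K^delta] are at least 1. *)
have low : low_energy_subsets D theta kappa.
  move=> X sXD thX; rewrite leNgt; apply/negP => eX; apply: nex.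
  exists X; split => //.
    by rewrite powK4.
  move=> delta /K_delta Kd; rewrite /energy card_energy_quadruples.
  have X0 : 0 < #|` X|%:R :> R by exact: lt_le_trans thX.
  have kE : kappa <= cross_energy R X X / #|` X|%:R ^+ 3.
    by rewrite ler_pdivlMr ?exprn_gt0 // ltW.
  apply: (le_trans kE); rewrite ler_peMl ?(le_trans (ltW k0)) //.
  by rewrite mulr_ege1 // /K0; lra.
have thA : 64 * K ^+ 3 * theta <= #|` A|%:R.
  have -> : 64 * K ^+ 3 * theta = 64 / K * #|` A|%:R.
    by rewrite /theta; field; rewrite gt_eqF.
  rewrite ler_piMl ?(ltW a0) // ler_pdivrMr // mul1r.
  by move: geK; rewrite /K0; lra.
have := low_energy_doubling A0 DK K1 th0 thA k0 k1 low; rewrite -/N.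
have -> : kappa ^+ 167 = K `^ (- (36 / 37) * 167).
  by rewrite powRrM -kappaE powR_mulrn // ltW.
apply/negP; rewrite -ltNge.
have le162 : K `^ (- (36 / 37) * 167) <= K ^- 162.
  rewrite -powR_mulrn ?(ltW Kpos) // -powRN ler_powR //; lra.
apply: (@le_lt_trans _ _ (N * K ^- 162 * K ^+ 161)).
  by rewrite ler_wpM2r ?exprn_ge0 ?(ltW Kpos) // ler_wpM2l.
have -> : N * K ^- 162 * K ^+ 161 = N / K.
  by rewrite -mulrA [K ^+ 162]exprS invfM mulfVK // expf_neq0 // gt_eqF.
by rewrite ltr_pdivrMr // mul1r; move: geK; rewrite /K0; lra.
Qed.

Theorem theorem3p1 (R : realType) :
  (exists eps C : R, [/\ 0 < eps, 0 < C & large_energetic_subset eps C]) /\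
  (exists2 C : R, 0 < C & large_energetic_subset (1 / 37%:R) C).
Proof.
have h := large_energetic_subset_37 R; split; last by exists 4.
by exists (1 / 37%:R), 4; split => //; rewrite divr_gt0.
Qed.
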